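(* For $1/4 \leq \theta \leq 1/3$, we have $g(\theta) \leq 1 - \theta$; that is, there exist constants $c_1, c_2 > 0$ such that for all sufficiently large real $x$ the interval $[x - c_1 x^{1-\theta}, x + c_1 x^{1-\theta}]$ contains an integer $n = a_1 b_1 = a_2 b_2$ with integers $a_1 < a_2 \leq b_2 < b_1$ all lying in $[x^{1/2} - c_2 x^\theta, x^{1/2} + c_2 x^\theta]$.
   Context: For $0 \leq \theta < 1/2$, $g(\theta)$ denotes the least (infimum) exponent $\gamma$ for which there exist constants $c_1, c_2 > 0$ (possibly depending on $\theta$) such that, for all sufficiently large real $x$, the interval $[x - c_1 x^{\gamma}, x + c_1 x^{\gamma}]$ contains an integer $n$ with $n = a_1 b_1 = a_2 b_2$, where $a_1 < a_2 \leq b_2 < b_1$ are integers in the interval $[x^{1/2} - c_2 x^\theta, x^{1/2} + c_2 x^\theta]$. *)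

(* Defs.v *)
From Stdlib Require Import Reals ZArith.
From Coquelicot Require Import Coquelicot.

Open Scope R_scope.

Definition in_window (c r : R) (m : Z) : Prop :=
  c - r <= IZR m <= c + r.

(* For x > 0, [Rpower x s] is the real power x^s and [sqrt x] is x^(1/2);
   [admissible] only constrains large x. *)
Definition two_close_factorizations (theta c2 x : R) (n : Z) : Prop :=
  exists a1 b1 a2 b2 : Z,
    n = (a1 * b1)%Z /\ n = (a2 * b2)%Z /\
    (a1 < a2)%Z /\ (a2 <= b2)%Z /\ (b2 < b1)%Z /\
    in_window (sqrt x) (c2 * Rpower x theta) a1 /\
    in_window (sqrt x) (c2 * Rpower x theta) b1 /\
    in_window (sqrt x) (c2 * Rpower x theta) a2 /\
    in_window (sqrt x) (c2 * Rpower x theta) b2.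

Definition admissible (theta gamma : R) : Prop :=
  exists c1 c2 : R, 0 < c1 /\ 0 < c2 /\
    exists x0 : R, forall x : R, x0 <= x ->
      exists n : Z,
        in_window x (c1 * Rpower x gamma) n /\
        two_close_factorizations theta c2 x n.

(* The infimum is taken in the extended reals, so that no default value is
   assigned when the set of admissible exponents is empty or unbounded below.
   Only 0 <= theta < 1/2 is meaningful. *)
Definition g (theta : R) : Rbar := Glb_Rbar (admissible theta).

(* Main.v *)
(** Take [n = d (d + 1) e (e + 1)] with the four factors [d e], [e (d + 1)],
    [d (e + 1)], [(d + 1) (e + 1)], where [e] is about [x^(1/2 - theta)] and
    [d] about [x^theta]. With [D = 2 d + 1] and [E = 2 e + 1] one has
    [16 n = (D^2 - 1) (E^2 - 1)], so [n] is close to [x] as soon as [D E] is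
    close to [4 sqrt x]; fixing [E] and moving [D] brings [D E] within [O(E)] of
    [4 sqrt x], an error [O(sqrt x * E) = O(x^(1 - theta))] in [n]. The error
    [D^2 = O(x^(2 theta))] is admissible since [theta <= 1/3], while
    [theta >= 1/4] ensures [E = O(x^theta)]. *)

Require Import Defs.
From Stdlib Require Import Reals ZArith Lra Lia.
From Coquelicot Require Import Coquelicot.
Open Scope R_scope.

(** Here [u] and [v] stand for [x^(1/2 - theta)] and [x^theta], so [u * v] is [sqrt x]. *)
Lemma exists_consecutive_pairs (u v : R) :
  4 <= u -> u <= v ->
  exists d e : Z,
    (0 < e)%Z /\ (e < d)%Z /\
    u <= 2 * IZR e + 1 <= 2 * u /\
    4 * (u * v) <= (2 * IZR d + 1) * (2 * IZR e + 1) <= 4 * (u * v) + 4 * u /\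
    2 * IZR d + 1 <= 5 * v.
Proof.
  intros Hu Huv.
  destruct (archimed u) as [Hup1 Hup2].
  (* The shift by 2 gives [e <= u - 1], hence [E <= 2 * u] and [q >= 2 * v]; then
     [d > v - 1/2 > e]. *)
  set (e := (up u - 2)%Z).
  assert (He : IZR e = IZR (up u) - 2) by (unfold e; now rewrite minus_IZR).
  set (E := 2 * IZR e + 1).
  assert (HE : u <= E <= 2 * u - 1) by (unfold E; lra).
  set (q := 4 * (u * v) / E).
  assert (HqE : q * E = 4 * (u * v)) by (unfold q; field; lra).
  (* Rounding up puts [2 * d + 1] in [(q, q + 2]], so its product with [E] exceeds [4 * (u * v)] by
     at most [2 * E <= 4 * u]. *)
  destruct (archimed ((q - 1) / 2)) as [Hd1 Hd2].
  set (d := up ((q - 1) / 2)) in *.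
  assert (Hq2v : 2 * v <= q) by nra.
  assert (Hq4v : q <= 4 * v) by nra.
  exists d, e; repeat split.
  - apply lt_IZR; lra.
  - apply lt_IZR; unfold E in HE; lra.
  - apply HE.
  - fold E; lra.
  - fold E; nra.
  - fold E; nra.
  - lra.
Qed.

(** The hypothesis [v <= u * u] absorbs [D^2 <= 25 * v^2] into the error [u * u * v]; the extreme
    factors deviate from [u * v] by [O(D + E) = O(v)]. *)
Lemma consecutive_products_close (u v d e : R) :
  4 <= u -> u <= v -> v <= u * u -> 0 < d -> 0 < e ->
  u <= 2 * e + 1 <= 2 * u ->
  4 * (u * v) <= (2 * d + 1) * (2 * e + 1) <= 4 * (u * v) + 4 * u ->
  2 * d + 1 <= 5 * v ->
  (u * v) * (u * v) - 5 * (u * u * v) <= (d * e) * ((d + 1) * (e + 1))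
    <= (u * v) * (u * v) + 5 * (u * u * v) /\
  u * v - 4 * v <= d * e /\ (d + 1) * (e + 1) <= u * v + 4 * v.
Proof.
  intros Hu Huv Hvu Hd He HE HDE HD.
  set (D := 2 * d + 1) in *; set (E := 2 * e + 1) in *.
  assert (HD1 : 1 < D) by (unfold D; lra).
  assert (HE1 : 1 < E) by (unfold E; lra).
  assert (Hn : 16 * ((d * e) * ((d + 1) * (e + 1)))
               = (D * E) * (D * E) - D * D - E * E + 1)
    by (unfold D, E; ring).
  assert (Hde : 4 * (d * e) = D * E - D - E + 1) by (unfold D, E; ring).
  assert (Hde1 : 4 * ((d + 1) * (e + 1)) = D * E + D + E + 1)
    by (unfold D, E; ring).
  assert (Hvv : v * v <= u * u * v) by (apply Rmult_le_compat_r; lra).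
  assert (HDD : D * D <= 25 * (u * u * v)).
  { assert (D * D <= (5 * v) * (5 * v)) by (apply Rmult_le_compat; lra). lra. }
  assert (Huu : (u * u) * 4 <= u * u * v) by (apply Rmult_le_compat_l; nra).
  assert (HEE : E * E <= u * u * v).
  { assert (E * E <= (2 * u) * (2 * u)) by (apply Rmult_le_compat; lra). lra. }
  assert (HD2 : 1 <= D * D) by nra.
  assert (HE2 : 1 <= E * E) by nra.
  assert (Huv0 : 0 <= u * v) by nra.
  assert (Hlow : (4 * (u * v)) * (4 * (u * v)) <= (D * E) * (D * E))
    by (apply Rmult_le_compat; lra).
  assert (Hup : (D * E) * (D * E)
                <= (4 * (u * v) + 4 * u) * (4 * (u * v) + 4 * u))
    by (apply Rmult_le_compat; lra).
  assert (Hexp : (4 * (u * v) + 4 * u) * (4 * (u * v) + 4 * u)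
                 = 16 * ((u * v) * (u * v)) + 32 * (u * u * v) + 16 * (u * u))
    by ring.
  repeat split; lra.
Qed.

Lemma admissible_one_sub (theta : R) :
  1 / 4 <= theta <= 1 / 3 -> admissible theta (1 - theta).
Proof.
  intros Htheta.
  exists 5, 4; split; [lra | split; [lra |]].
  (* Since [1/2 - theta >= 1/6], this threshold forces [u >= x^(1/6) >= 4]. *)
  exists (Rpower 4 6); intros x Hx.
  assert (H46 : 1 < Rpower 4 6).
  { rewrite <- (Rpower_O 4) by lra; apply Rpower_lt; lra. }
  set (v := Rpower x theta).
  set (u := Rpower x (1 / 2 - theta)).
  assert (Hs : sqrt x = u * v).
  { unfold u, v; rewrite <- Rpower_plus, <- Rpower_sqrt by lra; f_equal; lra. }
  assert (Hxx : x = (u * v) * (u * v)) by (rewrite <- Hs, sqrt_sqrt; lra).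
  assert (Hg : Rpower x (1 - theta) = u * u * v).
  { unfold u, v; rewrite <- !Rpower_plus; f_equal; lra. }
  (* This is [theta >= 1/4]; the next bound is [theta <= 1/3]. *)
  assert (Huv : u <= v) by (apply Rle_Rpower; lra).
  assert (Hvu : v <= u * u).
  { unfold u; rewrite <- Rpower_plus; apply Rle_Rpower; lra. }
  assert (Hu : 4 <= u).
  { replace 4 with (Rpower (Rpower 4 6) (1 / 6)).
    - apply Rle_trans with (Rpower x (1 / 6)).
      + apply Rle_Rpower_l; lra.
      + apply Rle_Rpower; lra.
    - rewrite Rpower_mult; replace (6 * (1 / 6)) with 1 by lra.
      apply Rpower_1; lra. }
  destruct (exists_consecutive_pairs u v Hu Huv)
    as (d & e & He0 & Hed & HE & HDE & HD).
  assert (He : 0 < IZR e) by now apply IZR_lt.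
  assert (Hd : IZR e < IZR d) by now apply IZR_lt.
  destruct (consecutive_products_close u v (IZR d) (IZR e))
    as (Hn & Hlo & Hhi); try lra.
  exists (d * e * ((d + 1) * (e + 1)))%Z; split.
  - unfold in_window; rewrite Hg, !mult_IZR, !plus_IZR; lra.
  (* The middle factors are [d * e + e] and [d * e + d], ordered by [e < d]; lying between the
     extreme ones, they inherit the window bounds. *)
  - exists (d * e)%Z, ((d + 1) * (e + 1))%Z, (e * (d + 1))%Z, (d * (e + 1))%Z.
    unfold in_window; fold v; rewrite Hs, !mult_IZR, !plus_IZR.
    repeat split; solve [ring | nia | nra].
Qed.

Theorem theorem3 (theta : R) (Htheta : 1 / 4 <= theta <= 1 / 3) :
  Rbar_le (g theta) (Finite (1 - theta)) /\ admissible theta (1 - theta).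
Proof.
  pose proof (admissible_one_sub theta Htheta) as Hadm.
  split; [| exact Hadm].
  exact (proj1 (Glb_Rbar_correct (admissible theta)) _ Hadm).
Qed.
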